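(* Let $0<c<1$ be a small constant. Suppose $2\le k\le\sqrt n$, $0<\rho<1$ and $\rho\ge\frac{ck^2}{n}$. Then there exists a universal constant $c'>0$ (not depending on $n,k,\rho,D$) such that, for any integer $D\ge1$, $$\inf_{\widehat M\in\mathbb R[A]^{n\times n}_{\le D}}\ \sup_{M\in\mathcal M_{k,\rho}}\ \mathbb E\big(\ell(\widehat M,M)\big)\ \ge\ \frac{c'\rho k}{nD^4}.$$
   Context: $[k]=\{1,\dots,k\}$. The sparse SBM class is $$\mathcal M_{k,\rho}=\{M\in[0,\rho]^{n\times n}: M_{ii}=0\ (i\in[n]),\ M_{ij}=M_{ji}=Q_{z_iz_j}\ (i\ne j)\ \text{for some } z\in[k]^n,\ Q=Q^\top\in[0,\rho]^{k\times k}\}.$$ Given $M$, one observes a symmetric $A\in\{0,1\}^{n\times n}$ with $A_{ii}=0$ and $A_{ij}=A_{ji}\sim\mathrm{Bernoulli}(M_{ij})$ independent over $1\le i<j\le n$; $\mathbb E$ is over $A$ given $M$. The loss is $\ell(\widehat M,M)=\binom n2^{-1}\sum_{1\le i<j\le n}(\widehat M_{ij}-M_{ij})^2$. The notation $\widehat M\in\mathbb R[A]^{n\times n}_{\le D}$ means every entry $\widehat M_{ij}$ is a real polynomial of degree at most $D$ in the entries of $A$. *)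

(* Defs.v *)
From HB Require Import structures.
From mathcomp Require Import all_boot all_order all_algebra.
From mathcomp Require Import boolp classical_sets reals constructive_ereal ereal.
From mathcomp Require Import bernoulli_distribution.
(* The notations of mpoly clash with those of the analysis library. *)
From mathcomp Require Import -(notations) mpoly.

Set Implicit Arguments.
Unset Strict Implicit.
Unset Printing Implicit Defensive.

Import Order.TTheory GRing.Theory Num.Theory.

Local Open Scope classical_set_scope.
Local Open Scope ring_scope.

Definition sbm_class (R : realType) (n k : nat) (rho : R) : set 'M[R]_n :=
  [set M : 'M[R]_n | (forall i j, 0 <= M i j <= rho) /\
           (forall i, M i i = 0) /\
           exists (z : 'I_n -> 'I_k) (Q : 'M[R]_k),
             [/\ Q = Q^T,
                 forall a b, 0 <= Q a b <= rho &
                 forall i j, i != j -> M i j = M j i /\ M j i = Q (z i) (z j)]].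

Definition is_adjacency (n : nat) (A : 'M[bool]_n) : bool :=
  (A == A^T) && [forall i, ~~ A i i].

Definition graph_prob (R : realType) (n : nat) (M : 'M[R]_n)
    (A : 'M[bool]_n) : R :=
  \prod_(i < n) \prod_(j < n | (i < j)%N) bernoulli_pmf (M i j) (A i j).

(* The sample space of the observed graph is finite, so the expectation given
   M is a finite sum over adjacency matrices. *)
Definition graph_expectation (R : realType) (n : nat) (M : 'M[R]_n)
    (f : 'M[bool]_n -> R) : R :=
  \sum_(A : 'M[bool]_n | is_adjacency A) graph_prob M A * f A.

Definition loss (R : realType) (n : nat) (Mhat M : 'M[R]_n) : R :=
  ('C(n, 2)%:R)^-1 *
  \sum_(i < n) \sum_(j < n | (i < j)%N) (Mhat i j - M i j) ^+ 2.

(* Polynomials in the n * n entries of A, indexed as in mxvec; msize is one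
   more than the total degree (and 0 for the zero polynomial). *)
Definition low_degree_estimator (R : realType) (n D : nat) :
    set ('M[bool]_n -> 'M[R]_n) :=
  [set Mhat : 'M[bool]_n -> 'M[R]_n | forall i j,
   exists2 p : mpoly (n * n) R,
     (msize p <= D.+1)%N &
     forall A, Mhat A i j =
       meval (fun v => mxvec (map_mx (fun b : bool => b%:R) A) 0 v) p].

(* Main.v *)
(** Draw the labels [z] uniformly in [[k]^n] and let [M_ij = q + eps] inside the
    blocks and [q] outside, with [q = rho / 4] and [eps^2] of order
    [rho k^2 / (n D^4)].  Fix a pair of vertices [r1, r2] and let [x] be the
    indicator of [z_r1 = z_r2], so that [M_r1r2 = q + eps x].  The Bayes risk
    over polynomials of degree [D] is bounded by duality: if a random variable
    [u] depending on [z] and [A] satisfies [E (u f) = E (x f)] for all [f] of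
    degree at most [D], then [E (f - x)^2 >= E x^2 - E u^2].  Take
      [u = sum_a eps^|a| w_a prod_(p in a) (A_p - M_p) / (M_p (1 - M_p))]
    over edge sets [a] with at most [D] elements; the products are orthogonal
    given [M], and the duality condition becomes the triangular system
      [sum_(a subset b) w_a P(b \ a monochromatic)
         = P(b monochromatic and z_r1 = z_r2)].
    Its solution vanishes unless every component of [a] contains [r1] or [r2],
    and is then at most [(|a| + 1)^|a| k^-(v - 1)], with [v] the number of
    vertices of [a] together with [r1, r2].  Building such edge sets one edge at
    a time gives [E u^2 <= (5 / 4) k^-2], to be compared with [E x^2 = 1 / k]. *)
Require Import Defs.
From HB Require Import structures.
From mathcomp Require Import classical_sets reals constructive_ereal ereal.
From mathcomp Require Import bernoulli_distribution.
(* After classical_sets, whose [subsetP] would otherwise shadow that of fintype. *)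
From mathcomp Require Import all_boot all_order all_algebra.
From mathcomp Require Import -(notations) mpoly.
From mathcomp Require Import ring lra zify.

Set Implicit Arguments.
Unset Strict Implicit.
Unset Printing Implicit Defensive.

Import Order.TTheory GRing.Theory Num.Theory.

Local Open Scope ring_scope.

(** * Edge sets attached to two roots *)

Section Rooted.
Variables (V : finType) (r1 r2 : V).
Implicit Types (a b g : {set V * V}) (f : V * V).

(** The endpoints of [g] together with both roots; no connectivity is asked. *)
Definition reach g : {set V} :=
  [set r1; r2] :|: ([set f.1 | f in g] :|: [set f.2 | f in g]).

Definition touches g f := (f.1 \in reach g) || (f.2 \in reach g).

(* Every component of the graph with edge set [a] contains [r1] or [r2]. *)
Definition rooted a :=
  [forall g : {set V * V}, (g \proper a) ==> [exists f in a :\: g, touches g f]].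

Lemma rootedP a :
  reflect (forall g, g \proper a -> exists2 f, f \in a :\: g & touches g f)
          (rooted a).
Proof.
apply: (iffP forallP) => [H g ga|H g].
  by have /implyP/(_ ga)/exists_inP[f ? ?] := H g; exists f.
by apply/implyP => /H[f ? ?]; apply/exists_inP; exists f.
Qed.

Lemma reachS a b : a \subset b -> reach a \subset reach b.
Proof. by move=> ab; rewrite /reach setUS// setUSS// imsetS. Qed.

Lemma touchesS a b f : a \subset b -> touches a f -> touches b f.
Proof.
by move=> /reachS/subsetP ab /orP[/ab|/ab] h; rewrite /touches h ?orbT.
Qed.

Lemma mem_reach1 g f : f \in g -> f.1 \in reach g.
Proof. by move=> fg; rewrite !inE (imset_f fst fg) orbT. Qed.

Lemma mem_reach2 g f : f \in g -> f.2 \in reach g.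
Proof. by move=> fg; rewrite !inE (imset_f snd fg) !orbT. Qed.

Lemma mem_reach_r1 g : r1 \in reach g.
Proof. by rewrite !inE eqxx. Qed.

Lemma reachP g v :
  reflect [\/ v = r1, v = r2 | exists2 f, f \in g & v = f.1 \/ v = f.2]
          (v \in reach g).
Proof.
rewrite !inE; apply: (iffP idP).
  case/orP => [/orP[/eqP|/eqP]|/orP[/imsetP[f fg ->]|/imsetP[f fg ->]]].
  - by constructor 1.
  - by constructor 2.
  - by constructor 3; exists f; auto.
  - by constructor 3; exists f; auto.
case=> [->|->|[f fg [->|->]]]; rewrite ?eqxx ?orbT//.
  by rewrite (imset_f fst fg) ?orbT.
by rewrite (imset_f snd fg) !orbT.
Qed.

Lemma reachU1 g f : reach (f |: g) = f.1 |: (f.2 |: reach g).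
Proof.
rewrite /reach !imsetU1; apply/setP => v; rewrite !inE.
by do !case: (_ == _); rewrite /= ?orbT.
Qed.

Lemma card_reach g : (#|reach g| <= 2 * #|g|.+1)%N.
Proof.
apply: leq_trans (leq_card_setU _ _) _.
have h2 : (#|[set r1; r2]| <= 2)%N by rewrite cards2; case: (_ == _).
have h0 := leq_card_setU [set f.1 | f in g] [set f.2 | f in g].
have l1 : (#|[set f.1 | f in g]| <= #|g|)%N by exact: leq_imset_card.
have l2 : (#|[set f.2 | f in g]| <= #|g|)%N by exact: leq_imset_card.
apply: leq_trans (leq_add h2 (leq_trans h0 (leq_add l1 l2))) _.
by rewrite mulnS leq_add2l addnn mul2n.
Qed.

Lemma rooted0 : rooted set0.
Proof.
by apply/rootedP => g; rewrite properE subset0 => /andP[/eqP->]; rewrite sub0set.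
Qed.

Lemma rootedU1 g f : rooted g -> touches g f -> rooted (f |: g).
Proof.
move=> /rootedP rg tf; apply/rootedP => h hp.
(* If [h] contains [g] then it misses [f], which touches it; otherwise rootedness of [g] is applied
   to [h :&: g]. *)
have [gh|gh] := boolP (g \subset h).
  exists f; last exact: touchesS tf.
  rewrite !inE eqxx /= andbT; apply: contraTN hp => fh.
  by rewrite properE negb_and negbK subUset sub1set fh gh orbT.
have /rg[e] : h :&: g \proper g.
  by rewrite properE subsetIr subsetI (negbTE gh).
rewrite !inE => /andP[eh eg] te; exists e.
  by move: eh; rewrite eg andbT !inE eg orbT andbT.
by apply: touchesS te; exact: subsetIl.
Qed.

(** The union of the components of [b] that meet a root, encoded as a rooted subset of maximal
    size. *)
Definition rooted_part b : {set V * V} :=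
  [arg max_(g > set0 | rooted g && (g \subset b)) #|g|].

Lemma rooted_partP b :
  [/\ rooted (rooted_part b), rooted_part b \subset b &
      forall f, f \in b :\: rooted_part b -> ~~ touches (rooted_part b) f].
Proof.
rewrite /rooted_part; case: arg_maxnP => [|g /andP[rg gb] gmax].
  by rewrite rooted0 sub0set.
split=> // f; rewrite inE => /andP[fg fb]; apply/negP => tf.
have := gmax (f |: g); rewrite rootedU1//= subUset sub1set fb gb => /(_ isT).
by rewrite cardsU1 fg add1n ltnn.
Qed.

(** Otherwise rootedness of [a] at [a :&: rooted_part b] gives an edge outside the rooted part that
    touches it, against maximality. *)
Lemma sub_rooted_part a b : rooted a -> a \subset b -> a \subset rooted_part b.
Proof.
move=> /rootedP ra ab; have [_ _ hC] := rooted_partP b.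
apply/negPn/negP => aC.
have /ra[f] : a :&: rooted_part b \proper a.
  by rewrite properE subsetIl subsetI subxx /= (negbTE aC).
rewrite !inE => /andP[+ fa]; rewrite fa /= => fC /(touchesS (subsetIr _ _)).
by apply/negP/hC; rewrite inE fC (subsetP ab).
Qed.

(** A largest rooted proper subset misses exactly one edge: some edge of [a] touches it, and adding
    that edge keeps it rooted, so maximality forces the result to be [a]. *)
Lemma rooted_remove a : rooted a -> a != set0 ->
  exists f, [/\ f \in a, rooted (a :\ f) & touches (a :\ f) f].
Proof.
move=> ra a0; pose P g := rooted g && (g \proper a).
have P0 : P set0 by rewrite /P rooted0 proper0.
case: (arg_maxnP (fun g : {set _} => #|g|) P0) => g /andP[rg ga] gmax.
have [f] := rootedP _ ra g ga; rewrite inE => /andP[fg fa] tf.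
have E : f |: g = a.
  apply/eqP; apply: contraTT (leqnn #|g|.+1) => ne.
  have := gmax (f |: g); rewrite /P rootedU1//= properEneq ne /=.
  rewrite subUset sub1set fa (proper_sub ga) => /(_ isT).
  by rewrite cardsU1 fg add1n ltnn.
have E' : a :\ f = g by rewrite -E setU1K.
by exists f; rewrite E'.
Qed.

(* Induction along an exploration of a rooted edge set from the roots. *)
Lemma rooted_reach_ind a (P : pred V) : rooted a -> P r1 -> P r2 ->
  (forall f, f \in a -> P f.1 = P f.2) ->
  {in reach a, forall v, P v}.
Proof.
move=> /rootedP ra P1 P2 Pf.
pose g := [set f in a | P f.1].
have gE : g = a.
  apply/eqP; rewrite eqEsubset; apply/andP; split.
    by apply/subsetP => f; rewrite inE => /andP[].
  apply/negPn/negP => ag.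
  have /ra[f] : g \proper a.
    by rewrite properE ag andbT; apply/subsetP => f; rewrite inE => /andP[].
  rewrite !inE => /andP[+ fa]; rewrite fa /= => nP.
  have Pr v : v \in reach g -> P v.
    move/reachP => [->//|->//|[e]]; rewrite inE => /andP[ea Pe] [->//|->].
    by rewrite -Pf.
  by case/orP => /Pr; [|rewrite -Pf//]; rewrite (negbTE nP).
move=> v /reachP[->//|->//|[e]]; rewrite -{1}gE inE => /andP[ea Pe] [->//|->].
by rewrite -Pf.
Qed.

(** Each rooted set with [e + 1] edges is one with [e] edges plus a touching edge, which costs a
    factor [y] if it brings a new vertex. One end is among at most [2 * D] reached vertices, the
    other is old (weight 1) or new (weight [y]): in total at most
    [2 * (2 * D) * (2 * D + #|V| * y)]. *)
Lemma rooted_weight_sum (R : realFieldType) (y : R) (e D : nat) :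
  0 <= y <= 1 -> (e < D)%N -> 1 <= #|V|%:R * y ->
  \sum_(a : {set V * V} | rooted a && (#|a| == e.+1)) y ^+ #|reach a :\ r1|
  <= 12 * D%:R ^+ 2 * (#|V|%:R * y) *
     \sum_(a : {set V * V} | rooted a && (#|a| == e)) y ^+ #|reach a :\ r1|.
Proof.
move=> /andP[y0 y1] eD ny1.
pose wt a := y ^+ #|reach a :\ r1|.
have wt0 a : 0 <= wt a by exact: exprn_ge0.
apply: (@le_trans _ _ (\sum_(a : {set V * V} | rooted a && (#|a| == e))
    \sum_(f | touches a f) wt (f |: a))).
  rewrite pair_big_dep /=.
  pose Q (p : {set V * V} * (V * V)) :=
    rooted p.1 && (#|p.1| == e) && touches p.1 p.2.
  pose h (p : {set V * V} * (V * V)) := p.2 |: p.1.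
  (* Pairs are grouped by the edge set they produce; [rooted_remove] shows that each rooted [a] is
     produced at least once. *)
  rewrite [leRHS](partition_big h (fun=> true))//= big_mkcond /=.
  apply: ler_sum => a _; case: ifPn => [/andP[ra /eqP ca]|_]; last first.
    by apply: sumr_ge0.
  have [|f [fa rf tf]] := rooted_remove ra; first by rewrite -card_gt0 ca.
  have cf : #|a :\ f| = e by have := cardsD1 f a; rewrite fa ca => -[].
  rewrite (bigD1 (a :\ f, f)) /= ?rf ?cf ?tf ?eqxx /h /= ?setD1K ?eqxx//.
  by rewrite lerDl; apply: sumr_ge0 => i _; exact: wt0.
rewrite mulr_sumr; apply: ler_sum => a /andP[ra /eqP ca].
have cr : (#|reach a| <= 2 * D)%N.
  by apply: leq_trans (card_reach a) _; rewrite ca; lia.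
pose r := reach a.
pose ex (v : V) := if v \in r then 1 else y : R.
have ex0 v : 0 <= ex v by rewrite /ex; case: ifP.
have wtf f : touches a f -> wt (f |: a) <= wt a * (ex f.1 * ex f.2).
  rewrite /wt reachU1 /touches /ex -/r.
  have hr v : v \notin r -> #|(v |: r) :\ r1| = #|r :\ r1|.+1.
    move=> vr; have v1 : r1 != v by apply: contraNneq vr => <-; exact: mem_reach_r1.
    have := cardsD1 r1 (v |: r); rewrite cardsU1 vr (cardsD1 r1 r).
    by rewrite in_setU1 mem_reach_r1 orbT !add1n => -[].
  have hin v : v \in r -> v |: r = r.
    by move=> vr; apply/setUidPr; rewrite sub1set.
  have [h1|h1] := boolP (f.1 \in r); have [h2|h2] := boolP (f.2 \in r) => //= _.
  - by rewrite (hin _ h2) (hin _ h1) !mulr1.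
  - by rewrite setUCA (hin _ h1) (hr _ h2) exprSr mul1r.
  - by rewrite (hin _ h2) (hr _ h1) exprSr mulr1.
apply: (@le_trans _ _ (\sum_(f | touches a f) wt a * (ex f.1 * ex f.2))).
  exact: ler_sum.
rewrite -mulr_sumr mulrC ler_wpM2r//.
have sum_ex : \sum_v ex v <= 2 * D%:R + #|V|%:R * y.
  rewrite (bigID (mem r)) /= lerD//.
    rewrite (eq_bigr (fun=> 1)); last by move=> v; rewrite /ex => ->.
    by rewrite sumr_const -natrM ler_nat.
  rewrite (eq_bigr (fun=> y)); last by move=> v /negbTE; rewrite /ex => ->.
  rewrite sumr_const -(mulr_natl y) ler_wpM2r// ler_nat; exact: max_card.
have sum_r : \sum_(v in r) ex v <= 2 * D%:R.
  rewrite (eq_bigr (fun=> 1)); last by move=> v; rewrite /ex => ->.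
  by rewrite sumr_const -natrM ler_nat.
have split : \sum_(f | touches a f) ex f.1 * ex f.2 <=
    2 * ((\sum_(v in r) ex v) * \sum_v ex v).
  have S1 : \sum_(f : V * V | f.1 \in r) ex f.1 * ex f.2 =
      (\sum_(v in r) ex v) * \sum_v ex v.
    rewrite mulr_suml; under [RHS]eq_bigr do rewrite mulr_sumr.
    by rewrite pair_big /=; apply: eq_bigl => -[? ?] /=; rewrite andbT.
  have S2 : \sum_(f : V * V | f.2 \in r) ex f.1 * ex f.2 =
      (\sum_(v in r) ex v) * \sum_v ex v.
    rewrite mulrC mulr_suml; under [RHS]eq_bigr do rewrite mulr_sumr.
    by rewrite pair_big /=; apply: eq_bigl => -[? ?].
  rewrite mulr2n mulrDl !mul1r -{1}S1 -S2 (bigID (fun f : V * V => f.1 \in r)) /=.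
  apply: lerD.
    rewrite le_eqVlt; apply/orP; left; apply/eqP/eq_bigl => f.
    by rewrite /touches -/r; case: (f.1 \in r); rewrite //= ?andbF ?andbT.
  rewrite [leLHS]big_mkcond [leRHS]big_mkcond /=; apply: ler_sum => f _.
  rewrite /touches -/r; case: (f.1 \in r); case: (f.2 \in r) => //=.
  by rewrite mulr_ge0.
apply: le_trans split _.
have D1 : 1 <= D%:R :> R by rewrite ler1n; lia.
have s0 : 0 <= \sum_v ex v by exact: sumr_ge0.
apply: (@le_trans _ _ (2 * (2 * D%:R * (2 * D%:R + #|V|%:R * y)))).
  rewrite ler_wpM2l// ler_pM// ?sumr_ge0//.
set d := D%:R in D1 *; set N := #|V|%:R * y in ny1 *.
(* With [d] and [N] at least 1, [8 * d ^+ 2 + 4 * d * N <= 12 * d ^+ 2 * N]. *)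
have h1 : d ^+ 2 <= d ^+ 2 * N by rewrite ler_peMr// sqr_ge0.
have h2 : d * N <= d ^+ 2 * N.
  by rewrite expr2 -mulrA ler_peMl// mulr_ge0//; exact: le_trans ny1.
lra.
Qed.
End Rooted.

(** * Random colourings and the dual weights *)

(** Recursion on the size of [b]: the first argument of [v] is fuel, and its value is irrelevant
    once it exceeds [#|b|]. *)
Lemma triangular_system (R : pzRingType) (E : finType) (F : {set E} -> R)
    (G : {set E} -> {set E} -> R) :
  exists w : {set E} -> R,
    forall b, w b = F b - \sum_(a : {set E} | a \proper b) w a * G b a.
Proof.
pose fix v (n : nat) (b : {set E}) {struct n} : R := if n is m.+1 then
  F b - \sum_(a : {set E} | a \proper b) v m a * G b a else 0.
have vE n m (b : {set E}) : (#|b| < n)%N -> (#|b| < m)%N -> v n b = v m b.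
  elim: n m b => [//|n IH] [//|m] b bn bm /=; congr (_ - _).
  apply: eq_bigr => a /proper_card ab; congr (_ * _).
  by apply: IH; exact: leq_trans ab _.
exists (fun b : {set E} => v #|b|.+1 b) => b.
transitivity (F b - \sum_(a : {set E} | a \proper b) v #|b| a * G b a) => //.
congr (_ - _); apply: eq_bigr => a ab; congr (_ * _).
by apply: vE => //; exact: proper_card.
Qed.

(** * Expectation over a uniformly random colouring *)

Section Average.
Variables (R : realFieldType) (V C : finType).
Hypothesis C_gt0 : (0 < #|C|)%N.
Implicit Types (a b : {ffun V -> C}) (F G : {ffun V -> C} -> R).

Definition avg F : R := #|{ffun V -> C}|%:R^-1 * \sum_a F a.

Lemma card_colorings_gt0 : 0 < #|{ffun V -> C}|%:R :> R.
Proof. by rewrite ltr0n card_ffun expn_gt0 C_gt0. Qed.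

Lemma eq_avg F G : F =1 G -> avg F = avg G.
Proof. by move=> FG; rewrite /avg; under eq_bigr do rewrite FG. Qed.

Lemma avgZ c F : avg (fun a => c * F a) = c * avg F.
Proof. by rewrite /avg -mulr_sumr mulrCA. Qed.

Lemma avgD F G : avg (fun a => F a + G a) = avg F + avg G.
Proof. by rewrite /avg big_split mulrDr. Qed.

Lemma avg_sum (I : Type) (r : seq I) (P : pred I) (H : I -> {ffun V -> C} -> R) :
  avg (fun a => \sum_(i <- r | P i) H i a) = \sum_(i <- r | P i) avg (H i).
Proof. by rewrite /avg exchange_big -mulr_sumr. Qed.

Lemma avg_cst c : avg (fun=> c) = c.
Proof.
rewrite /avg sumr_const -[c *+ _]mulr_natl mulKf// gt_eqF//.
exact: card_colorings_gt0.
Qed.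

Lemma ler_avg F G : (forall a, F a <= G a) -> avg F <= avg G.
Proof. by move=> FG; rewrite /avg ler_wpM2l ?invr_ge0 ?ler0n// ler_sum. Qed.

Lemma avg_ge0 F : (forall a, 0 <= F a) -> 0 <= avg F.
Proof. by move=> F0; rewrite -[0](avg_cst 0) ler_avg. Qed.

Lemma avg_pred (S : pred {ffun V -> C}) :
  avg (fun a => (S a)%:R) = #|{ffun V -> C}|%:R^-1 * #|[set a | S a]|%:R.
Proof.
by rewrite /avg -natr_sum -sum1dep_card [in RHS]big_mkcond.
Qed.

(** Resetting the colours on [W] to a fixed colour is injective on [S], so [S] has at most
    [#|C| ^ #|~: W|] elements. *)
Lemma avg_determined (S : pred {ffun V -> C}) (W : {set V}) :
  (forall a b, S a -> S b -> {in ~: W, a =1 b} -> a = b) ->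
  avg (fun a => (S a)%:R) <= #|C|%:R^-1 ^+ #|W|.
Proof.
move=> inj; rewrite avg_pred.
pose c0 := enum_val (Ordinal C_gt0).
pose h a : {ffun V -> C} := [ffun v => if v \in W then c0 else a v].
have hS : (#|[set a | S a]| <= #|C| ^ #|~: W|)%N.
  have <- : #|h @: [set a | S a]| = #|[set a | S a]|.
    apply: card_in_imset => a b; rewrite !inE => Sa Sb hab; apply: inj => // v.
    rewrite inE => vW; have := congr1 (fun g : {ffun V -> C} => g v) hab.
    by rewrite !ffunE (negbTE vW).
  have <- : #|pffun_on c0 (~: W) (predT : pred C)| = (#|C| ^ #|~: W|)%N.
    by rewrite card_pffun_on; congr (_ ^ _)%N.
  apply/subset_leq_card/subsetP => _ /imsetP[a _ ->].
  apply/pffun_onP; split => //; apply/subsetP => v; rewrite !inE ffunE.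
  by case: (v \in W); rewrite ?eqxx.
rewrite card_ffun exprVn mulrC ler_pdivrMr ?ltr0n ?expn_gt0 ?C_gt0//.
rewrite mulrC ler_pdivlMr -?natrX ?ltr0n ?expn_gt0 ?C_gt0//.
by rewrite -natrM ler_nat -(cardsC W) expnD mulnC leq_mul2l hS orbT.
Qed.

(* Splicing [a] with an independent copy [b] in both directions is an involution
   of pairs of colourings; this exchanges [F a * G a] and [F a * G b]. *)
Definition splice (U : {set V}) a b : {ffun V -> C} :=
  [ffun v => if v \in U then a v else b v].

Lemma avg_indep (U : {set V}) F G :
  (forall a b, {in U, a =1 b} -> F a = F b) ->
  (forall a b, {in ~: U, a =1 b} -> G a = G b) ->
  avg (fun a => F a * G a) = avg F * avg G.
Proof.
move=> FU GU; rewrite /avg.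
set N := #|_|%:R; have N0 : N != 0 by rewrite gt_eqF// card_colorings_gt0.
suff E : N * \sum_a F a * G a = (\sum_a F a) * (\sum_a G a).
  by rewrite mulrACA -E !mulrA divfK.
pose s (p : {ffun V -> C} * {ffun V -> C}) := (splice U p.1 p.2, splice U p.2 p.1).
have sK : involutive s.
  by move=> [a b]; rewrite /s /=; congr pair; apply/ffunP => v;
    rewrite !ffunE; case: ifP => // ->.
rewrite [RHS]mulr_suml; under [RHS]eq_bigr do rewrite mulr_sumr.
rewrite pair_big /= (reindex_inj (inv_inj sK)) /=.
rewrite [RHS](eq_bigr (fun p => F p.1 * G p.1)); last first.
  move=> [a b] _ /=; congr (_ * _); [apply: FU|apply: GU] => v vU.
    by rewrite ffunE vU.
  by rewrite ffunE; move: vU; rewrite inE => /negbTE->.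
rewrite -(pair_big predT predT (fun a b => F a * G a)) /= mulr_sumr.
by apply: eq_bigr => a _; rewrite sumr_const mulr_natl.
Qed.

(** Overwriting the colour of [u] is a bijection from [S] times [C] onto all colourings, because on
    [S] the lost colour is that of [v]. *)
Lemma avg_eq_at (u v : V) : u != v ->
  avg (fun a => (a u == a v)%:R) = #|C|%:R^-1.
Proof.
move=> uv; have vu : (v == u) = false by rewrite eq_sym (negbTE uv).
rewrite avg_pred.
set S := [set a : {ffun V -> C} | a u == a v].
have C0 : #|C|%:R != 0 :> R by rewrite pnatr_eq0 -lt0n.
apply: (mulIf C0); rewrite mulVf// -mulrA -natrM.
suff -> : (#|S| * #|C|)%N = #|{ffun V -> C}|.
  by rewrite mulVf// gt_eqF// card_colorings_gt0.
pose h (p : {ffun V -> C} * C) : {ffun V -> C} :=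
  [ffun x => if x == u then p.2 else p.1 x].
rewrite -[#|C|]cardsT -cardsX -(card_in_imset (f := h)).
  rewrite -[RHS]cardsT; apply: eq_card => b; rewrite !inE.
  apply/imsetP; exists ([ffun x => if x == u then b v else b x], b u).
    by rewrite !inE /= !ffunE eqxx vu eqxx.
  by apply/ffunP => x; rewrite !ffunE /=; case: eqP => [->//|].
move=> [a c] [b d]; rewrite !inE /= !andbT => /eqP ha /eqP hb hab.
have E x := congr1 (fun g : {ffun V -> C} => g x) hab.
have cd : c = d by have := E u; rewrite !ffunE eqxx.
congr pair => //; apply/ffunP => x.
have [->|xu] := eqVneq x u; last by have := E x; rewrite !ffunE (negbTE xu).
by rewrite ha hb; have := E v; rewrite !ffunE vu.
Qed.
End Average.

(** * Monochromatic edge sets and the dual weights *)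

Section Weights.
Variables (R : realFieldType) (V C : finType) (r1 r2 : V).
Hypothesis C_gt0 : (0 < #|C|)%N.
Implicit Types (z : {ffun V -> C}) (a b g : {set V * V}).

Definition mono z g := [forall f in g, z f.1 == z f.2].

Lemma monoP z g : reflect (forall f, f \in g -> z f.1 = z f.2) (mono z g).
Proof. exact: 'forall_in_eqP. Qed.

Lemma mono0 z : mono z set0.
Proof. by apply/monoP => f; rewrite inE. Qed.

Lemma monoU z a b : mono z (a :|: b) = mono z a && mono z b.
Proof.
apply/monoP/andP => [H|[/monoP Ha /monoP Hb] f].
  by split; apply/monoP => f fab; apply: H; rewrite inE fab ?orbT.
by rewrite inE => /orP[/Ha|/Hb].
Qed.

Let y : R := #|C|%:R^-1.
(** [r1] is removed because its colour stays free: for rooted monochromatic [a] with [z r1 = z r2],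
    it fixes the colours of the vertices counted here. *)
Let nu a := #|reach r1 r2 a :\ r1|.
Let P g : R := avg (fun z => (mono z g)%:R).
Let Px g : R := avg (fun z => (mono z g && (z r1 == z r2))%:R).

Lemma prob_mono0 : P set0 = 1.
Proof.
by rewrite -[RHS](@avg_cst _ V C C_gt0); apply: eq_avg => z; rewrite mono0.
Qed.

(** On this event the colour of [r1] spreads over all of [reach r1 r2 b], since [b] is rooted and
    the roots agree. *)
Lemma prob_mono_root_le b : rooted r1 r2 b -> Px b <= y ^+ nu b.
Proof.
move=> rb; apply: avg_determined => // z z'.
move=> /andP[/monoP mz /eqP z12] /andP[/monoP mz' /eqP z'12] zz'.
have cst (t : {ffun V -> C}) : (forall f, f \in b -> t f.1 = t f.2) ->
    t r1 = t r2 -> {in reach r1 r2 b, forall v, t v == t r1}.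
  move=> mt t12; apply: (rooted_reach_ind (P := fun v => t v == t r1)) rb _ _ _.
  - by rewrite eqxx.
  - by rewrite t12.
  - by move=> f fb; rewrite (mt f fb).
have h1 : z r1 = z' r1 by apply: zz'; rewrite !inE eqxx.
apply/ffunP => v; have [vb|vb] := boolP (v \in reach r1 r2 b).
  by rewrite (eqP (cst z mz z12 v vb)) (eqP (cst z' mz' z'12 v vb)).
by apply: zz'; rewrite in_setC in_setD negb_and vb orbT.
Qed.

(** Given the colours on the reach of [a], which contains both roots, the edges of [b :\: a] fix the
    colours of the [nu b - nu a] remaining vertices. *)
Lemma prob_mono_diff_le a b : rooted r1 r2 b -> a \subset b ->
  y ^+ nu a * P (b :\: a) <= y ^+ nu b.
Proof.
move=> rb ab; have rab := reachS r1 r2 ab.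
have -> : nu b = (nu a + #|reach r1 r2 b :\: reach r1 r2 a|)%N.
  have := cardsD1 r1 (reach r1 r2 a); have := cardsD1 r1 (reach r1 r2 b).
  rewrite !mem_reach_r1 -(cardsID (reach r1 r2 a) (reach r1 r2 b)).
  by rewrite (setIidPr rab) !add1n => + E; rewrite E addSn => -[].
rewrite exprD ler_wpM2l ?exprn_ge0 ?invr_ge0 ?ler0n//.
apply: avg_determined => // z z' /monoP mz /monoP mz' zz'.
have E : {in reach r1 r2 a, z =1 z'}.
  by move=> v va; apply: zz'; rewrite in_setC in_setD va.
have H : {in reach r1 r2 b, forall v, z v == z' v}.
  apply: (rooted_reach_ind (P := fun v => z v == z' v)) rb _ _ _.
  - by rewrite E// !inE eqxx.
  - by rewrite E// !inE eqxx ?orbT.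
  - move=> f fb; have [fa|fa] := boolP (f \in a).
      by rewrite !E// ?mem_reach1 ?mem_reach2// !eqxx.
    by rewrite mz ?mz'// inE fa.
apply/ffunP => v; have [/H/eqP//|vb] := boolP (v \in reach r1 r2 b).
by apply: zz'; rewrite in_setC in_setD negb_and vb orbT.
Qed.

(** By maximality of [c], the edges of [b :\: c] have both ends off its reach, hence are independent
    of [F]. *)
Lemma prob_mono_factor b (c := rooted_part r1 r2 b) (F : {ffun V -> C} -> R) :
  (forall z z', {in reach r1 r2 c, z =1 z'} -> F z = F z') ->
  avg (fun z => F z * (mono z (b :\: c))%:R) = avg F * P (b :\: c).
Proof.
move=> Fc; apply: avg_indep (reach r1 r2 c) _ _ _ _ => // z z' zz'.
have [_ _ nt] := rooted_partP r1 r2 b.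
congr (_%:R); congr nat_of_bool.
have E f : f \in b :\: c -> (z f.1 = z' f.1) * (z f.2 = z' f.2).
  move=> /nt; rewrite negb_or => /andP[h1 h2].
  by split; apply: zz'; rewrite inE.
by apply/monoP/monoP => H f fb; have := H f fb; rewrite !E.
Qed.

(* An edge set splits into its rooted part and edges on disjoint vertices, so both
   sides of the system factor and it need only be solved on rooted sets.  The
   constant comes from [sum_(j < e) 'C(e, j) (j + 1)^j + 1 <= (e + 1)^e]. *)
Lemma exists_dual_weights : exists w : {set V * V} -> R,
  [/\ forall a, ~~ rooted r1 r2 a -> w a = 0,
      forall b, \sum_(a : {set V * V} | a \subset b) w a * P (b :\: a) = Px b &
      forall b, `|w b| <= (#|b|.+1 ^ #|b|)%:R * y ^+ nu b].
Proof.
(* Zero data off the rooted sets make [w] vanish there, while on rooted [b] the true system is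
   solved. *)
have [w wE] := triangular_system (fun b => if rooted r1 r2 b then Px b else 0)
  (fun b a => if rooted r1 r2 b then P (b :\: a) else 0).
have w0 a : ~~ rooted r1 r2 a -> w a = 0.
  by move=> /negbTE ra; rewrite wE ra big1 ?subr0// => b _; rewrite mulr0.
have wr b : rooted r1 r2 b ->
    \sum_(a : {set V * V} | a \subset b) w a * P (b :\: a) = Px b.
  move=> rb; rewrite (bigD1 b) //= setDv prob_mono0 mulr1 {1}wE rb.
  under eq_bigl do rewrite andbC -properEneq.
  by rewrite subrK.
exists w; split => // [b|b].
- pose c := rooted_part r1 r2 b; have [rc cb nt] := rooted_partP r1 r2 b.
  transitivity ((\sum_(a : {set V * V} | a \subset c) w a * P (c :\: a)) *
                P (b :\: c)).
    (* Rooted subsets of [b] lie in [c], so all other terms vanish. *)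
    rewrite mulr_suml [LHS](bigID (fun a : {set V * V} => a \subset c)) /=.
    rewrite [X in _ + X]big1 ?addr0; last first.
      move=> a /andP[ab nac]; rewrite w0 ?mul0r//; apply: contra nac => ra.
      exact: sub_rooted_part.
    apply: eq_big => [a|a /andP[ab ac]].
      by apply/andP/idP => [[]//|ac]; split => //; apply: subset_trans cb.
    rewrite -mulrA; congr (_ * _).
    rewrite -prob_mono_factor.
      apply: eq_avg => z; rewrite -natrM mulnb -monoU; congr (_%:R).
      congr (nat_of_bool (mono z _)).
      apply/setP => f; rewrite !inE -/c.
      have := subsetP cb f; have := subsetP ac f.
      case: (f \in a); case: (f \in c); case: (f \in b) => //= h1 h2;
        solve [by have := h1 isT | by have := h2 isT].
    move=> z z' zz'; congr (_%:R); congr nat_of_bool.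
    have E f : f \in c :\: a -> (z f.1 = z' f.1) * (z f.2 = z' f.2).
      by case/setDP => fc _; split; apply: zz'; rewrite (mem_reach1, mem_reach2).
    by apply/monoP/monoP => H f fca; have := H f fca; rewrite !E.
  rewrite wr// -prob_mono_factor.
    apply: eq_avg => z; rewrite -natrM mulnb andbAC -monoU.
    by rewrite setDE setUIr setUCr setIT (setUidPr cb).
  move=> z z' zz'; congr (_%:R); congr nat_of_bool; congr andb.
    have E f : f \in c -> (z f.1 = z' f.1) * (z f.2 = z' f.2).
      by move=> fc; split; apply: zz'; rewrite (mem_reach1, mem_reach2).
    by apply/monoP/monoP => H f fc; have := H f fc; rewrite !E.
  by rewrite !zz' // !inE eqxx ?orbT.
- have [n] := ubnP #|b|; elim: n b => // n IH b bn.
  have y0 : 0 <= y by rewrite invr_ge0 ler0n.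
  have [rb|rb] := boolP (rooted r1 r2 b); last first.
    by rewrite w0// normr0 mulr_ge0 ?ler0n ?exprn_ge0.
  rewrite wE rb; apply: le_trans (ler_normB _ _) _.
  have Px0 : 0 <= Px b by apply: avg_ge0 => // z; rewrite ler0n.
  rewrite ger0_norm//.
  apply: (@le_trans _ _ ((1 + \sum_(a : {set V * V} | a \proper b)
      (#|a|.+1 ^ #|a|)%:R) * y ^+ nu b)).
    rewrite mulrDl mul1r lerD ?prob_mono_root_le// mulr_suml.
    apply: le_trans (ler_norm_sum _ _ _) _; apply: ler_sum => a ab.
    have P_ge0 : 0 <= P (b :\: a) by apply: avg_ge0 => // z; rewrite ler0n.
    rewrite normrM [`|P _|]ger0_norm//.
    have an : (#|a| < n)%N by apply: leq_trans (proper_card ab) _.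
    apply: le_trans (ler_wpM2r P_ge0 (IH a an)) _.
    rewrite -mulrA ler_wpM2l ?ler0n//.
    by apply: prob_mono_diff_le => //; exact: proper_sub.
  rewrite ler_wpM2r ?exprn_ge0// -natr_sum -(natrD _ 1) ler_nat.
  set e := #|b|.
  (* Binomial theorem over subsets of [b]: the term [a = b] absorbs the 1 (also for [e = 0], as
     [0 ^ 0 = 1]), and proper [a] satisfy [#|a| + 1 <= e]. *)
  have -> : (e.+1 ^ e = \sum_(a : {set V * V} | a \subset b) e ^ #|a|)%N.
    rewrite -add1n expnDn.
    rewrite [RHS](partition_big (fun a : {set V * V} => inord #|a| : 'I_e.+1) predT) //=.
    apply: eq_bigr => i _; rewrite exp1n mul1n.
    rewrite (eq_bigr (fun=> (e ^ i)%N)); last first.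
      move=> a /andP[ab /eqP <-]; rewrite inordK// ltnS; exact: subset_leq_card.
    rewrite sum_nat_const; congr (_ * _)%N.
    rewrite -cards_draws -cardsE; apply: eq_card => a; rewrite !inE.
    apply: andb_id2l => ab; rewrite -val_eqE /= inordK// ltnS.
    exact: subset_leq_card.
  rewrite [leqRHS](bigD1 b)//= leq_add//.
    by rewrite expn_gt0 lt0n orNb.
  rewrite [leqRHS](eq_bigl (fun a : {set V * V} => a \proper b)); last first.
    by move=> a; rewrite properEneq andbC.
  apply: leq_sum => a ab; have := proper_card ab.
  by rewrite -/e; case: #|a| => [|m] me; rewrite ?expn0// leq_exp2r.
Qed.
End Weights.

(** * Moments of the observed graph *)

Section Graphs.
Variables (R : realType) (n : nat).
Implicit Types (A : 'M[bool]_n) (M : 'M[R]_n) (a b g : {set 'I_n * 'I_n}).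
Implicit Types (F G : 'M[bool]_n -> R) (p : 'I_n * 'I_n).

Definition edges : {set 'I_n * 'I_n} := [set p : 'I_n * 'I_n | (p.1 < p.2)%N].

Lemma adj_sym A i j : is_adjacency A -> A i j = A j i.
Proof. by move=> /andP[/eqP AT _]; rewrite {1}AT mxE. Qed.

Lemma adj_diag A i : is_adjacency A -> A i i = false.
Proof. by move=> /andP[_ /forallP/(_ i)/negbTE]. Qed.

(** Adjacency matrices correspond to Boolean functions supported on [edges], so this is
    distributivity; it encodes the independence of the edges. *)
Lemma sum_adjacency_prod (H : 'I_n * 'I_n -> bool -> R) :
  \sum_(A | is_adjacency A) \prod_(p in edges) H p (A p.1 p.2) =
  \prod_(p in edges) (H p true + H p false).
Proof.
transitivity (\prod_(p in edges) \sum_(e : bool | predT e) H p e).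
  rewrite (big_distr_big false) /=.
  pose to A : {ffun 'I_n * 'I_n -> bool} := [ffun p => (p \in edges) && A p.1 p.2].
  pose of_ (f : {ffun 'I_n * 'I_n -> bool}) : 'M[bool]_n :=
    \matrix_(i, j) (f (i, j) || f (j, i)).
  rewrite [RHS](reindex_onto to of_) /=; last first.
    move=> f /pffun_onP[/subsetP sf _]; apply/ffunP => -[i j].
    rewrite !ffunE mxE /=; have := sf (i, j); have := sf (j, i).
    rewrite !inE /=; case: (f (i, j)) => [_ /(_ isT)->|+ _] //=.
    by case: (f (j, i)) => [/(_ isT) h|_]; rewrite ?andbF//= ltnNge ltnW.
  apply: eq_big => [A|A adjA]; last first.
    by apply: eq_bigr => p pE; rewrite ffunE pE.
  apply/idP/andP => [adjA|[_ /eqP <-]].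
    split.
      apply/pffun_onP; split => //; apply/subsetP => p.
      by rewrite !inE ffunE inE; case: ltnP.
    apply/eqP/matrixP => i j; rewrite mxE !ffunE !inE /= (adj_sym j i adjA).
    by rewrite -andb_orl; case: ltngtP => //= /ord_inj->; rewrite adj_diag.
  apply/andP; split; first by apply/eqP/matrixP => i j; rewrite !mxE orbC.
  by apply/forallP => i; rewrite mxE orbb ffunE inE ltnn.
by apply: eq_bigr => p _; rewrite big_bool.
Qed.

Lemma prod_edges (f : 'I_n -> 'I_n -> R) :
  \prod_(i < n) \prod_(j < n | (i < j)%N) f i j = \prod_(p in edges) f p.1 p.2.
Proof. by rewrite pair_big_dep /=; apply: eq_bigl => p; rewrite inE. Qed.

Lemma graph_expectation_prod M (h : 'I_n * 'I_n -> bool -> R) :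
  graph_expectation M (fun A => \prod_(p in edges) h p (A p.1 p.2)) =
  \prod_(p in edges)
    (M p.1 p.2 * h p true + (1 - M p.1 p.2) * h p false).
Proof.
rewrite /graph_expectation /graph_prob.
rewrite -(sum_adjacency_prod (fun p e => bernoulli_pmf (M p.1 p.2) e * h p e)).
apply: eq_bigr => A _.
by rewrite (prod_edges (fun i j => bernoulli_pmf (M i j) (A i j))) -big_split.
Qed.

Lemma eq_graph_expectation M F G :
  (forall A, is_adjacency A -> F A = G A) ->
  graph_expectation M F = graph_expectation M G.
Proof. by move=> FG; apply: eq_bigr => A adjA; rewrite FG. Qed.

Lemma graph_expectationD M F G :
  graph_expectation M (fun A => F A + G A) =
  graph_expectation M F + graph_expectation M G.
Proof. by rewrite -big_split; apply: eq_bigr => A _; rewrite mulrDr. Qed.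

Lemma graph_expectationZ M c F :
  graph_expectation M (fun A => c * F A) = c * graph_expectation M F.
Proof. by rewrite mulr_sumr; apply: eq_bigr => A _; rewrite mulrCA. Qed.

Lemma graph_expectation_sum M (I : Type) (r : seq I) (P : pred I)
    (H : I -> 'M[bool]_n -> R) :
  graph_expectation M (fun A => \sum_(i <- r | P i) H i A) =
  \sum_(i <- r | P i) graph_expectation M (H i).
Proof. by rewrite exchange_big; apply: eq_bigr => A _; rewrite mulr_sumr. Qed.

Lemma graph_expectation_ge0 M F :
  (forall p, p \in edges -> 0 <= M p.1 p.2 <= 1) -> (forall A, 0 <= F A) ->
  0 <= graph_expectation M F.
Proof.
move=> M01 F0; apply: sumr_ge0 => A _; apply: mulr_ge0 => //.
rewrite /graph_prob prod_edges; apply: prodr_ge0 => p pE.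
exact/bernoulli_pmf_ge0/M01.
Qed.

Lemma graph_expectation1 M : graph_expectation M (fun=> 1) = 1.
Proof.
transitivity (graph_expectation M
    (fun A => \prod_(p in edges) (fun _ _ => 1) p (A p.1 p.2))).
  by apply: eq_graph_expectation => A _; rewrite big1.
by rewrite (graph_expectation_prod M (fun _ _ => 1)) big1// => p _; rewrite !mulr1 subrKC.
Qed.

Lemma prod_sub_edges a (f : 'I_n * 'I_n -> R) : a \subset edges ->
  \prod_(p in a) f p = \prod_(p in edges) (if p \in a then f p else 1).
Proof.
move=> /setIidPr aE; rewrite -big_mkcondr; apply: eq_bigl => p.
by rewrite -{1}aE inE.
Qed.

(** Centred at the constant [q] rather than at [M]: a basis for estimators must not depend on the
    labels. *)
Definition shifted_monomial (q : R) b A : R :=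
  \prod_(p in b) ((A p.1 p.2)%:R - q).

(* Orthogonal given [M], and biorthogonal to the monomials in [A_p - q] up to
   lower terms. *)
Definition dual_monomial M a A : R :=
  \prod_(p in a) (((A p.1 p.2)%:R - M p.1 p.2) / (M p.1 p.2 * (1 - M p.1 p.2))).

Section Moments.
Variable M : 'M[R]_n.
Hypothesis M01 : forall p, p \in edges -> 0 < M p.1 p.2 < 1.

Lemma edge_prob_neq0 p : p \in edges -> M p.1 p.2 != 0 /\ 1 - M p.1 p.2 != 0.
Proof. by move=> /M01/andP[h0 h1]; rewrite subr_eq0 !gt_eqF. Qed.

(** The moment factors over edges: 1 for an edge in both sets, 0 for one only in [a] by centring,
    [M_p - q] for one only in [b]. *)
Lemma dual_shifted_moment q a b : a \subset edges -> b \subset edges ->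
  graph_expectation M (fun A => dual_monomial M a A * shifted_monomial q b A) =
  (a \subset b)%:R * \prod_(p in b :\: a) (M p.1 p.2 - q).
Proof.
move=> aE bE; pose phi p (e : bool) := (e%:R - M p.1 p.2) / (M p.1 p.2 * (1 - M p.1 p.2)).
pose h p e : R := (if p \in a then phi p e else 1) * (if p \in b then e%:R - q else 1).
rewrite (@eq_graph_expectation _ _
  (fun A => \prod_(p in edges) h p (A p.1 p.2))); last first.
  move=> A _; rewrite /dual_monomial /shifted_monomial.
  by rewrite (prod_sub_edges _ aE) (prod_sub_edges _ bE) -big_split.
rewrite graph_expectation_prod /h.
have [ab|/subsetPn[p pa pb]] := boolP (a \subset b).
  rewrite mul1r (prod_sub_edges _ (subset_trans (subsetDl b a) bE)).
  apply: eq_bigr => p pE; rewrite inE /phi; have [m0 m1] := edge_prob_neq0 pE.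
  have := subsetP ab p; case: (p \in a) => [/(_ isT)->|_] /=.
    by field; rewrite ?m0 ?m1.
  by case: (p \in b); ring.
rewrite mul0r; have pE := subsetP aE _ pa.
rewrite (bigD1 p) //= pa (negbTE pb) /phi; have [m0 m1] := edge_prob_neq0 pE.
rewrite [X in X * _](_ : _ = 0) ?mul0r//=.
by field; rewrite ?m0 ?m1.
Qed.

(** An edge in just one set gives a centred factor 0; an edge in both gives the Bernoulli variance
    divided by its square. *)
Lemma dual_moment a b : a \subset edges -> b \subset edges ->
  graph_expectation M (fun A => dual_monomial M a A * dual_monomial M b A) =
  (a == b)%:R * \prod_(p in a) (M p.1 p.2 * (1 - M p.1 p.2))^-1.
Proof.
move=> aE bE; pose phi p (e : bool) := (e%:R - M p.1 p.2) / (M p.1 p.2 * (1 - M p.1 p.2)).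
pose h p e : R := (if p \in a then phi p e else 1) * (if p \in b then phi p e else 1).
rewrite (@eq_graph_expectation _ _
  (fun A => \prod_(p in edges) h p (A p.1 p.2))); last first.
  move=> A _; rewrite /dual_monomial.
  by rewrite (prod_sub_edges _ aE) (prod_sub_edges _ bE) -big_split.
rewrite graph_expectation_prod /h.
have [<-|ab] := eqVneq a b.
  rewrite mul1r (prod_sub_edges _ aE).
  apply: eq_bigr => p pE; rewrite /phi; have [m0 m1] := edge_prob_neq0 pE.
  case: (p \in a) => /=; last by ring.
  by field; rewrite ?m0 ?m1.
rewrite mul0r; have [p pE pab] : exists2 p, p \in edges & (p \in a) != (p \in b).
  have [p pab] : exists p, (p \in a) != (p \in b).
    apply/existsP; apply: contraNT ab; rewrite negb_exists => /forallP H.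
    by apply/eqP/setP => p; have := H p; rewrite negbK => /eqP.
  exists p => //; have := subsetP aE p; have := subsetP bE p; move: pab.
  by case: (p \in a); case: (p \in b) => // _ h1 h2; [exact: h2|exact: h1].
rewrite (bigD1 p) //= /phi; have [m0 m1] := edge_prob_neq0 pE.
rewrite [X in X * _](_ : _ = 0) ?mul0r//.
by move: pab; case: (p \in a); case: (p \in b) => //= _; field;
  rewrite ?m0 ?m1.
Qed.

Lemma shifted_moment q b : b \subset edges ->
  graph_expectation M (shifted_monomial q b) = \prod_(p in b) (M p.1 p.2 - q).
Proof.
move=> bE; have := @dual_shifted_moment q set0 b (sub0set _) bE.
rewrite sub0set mul1r setD0 => <-; apply: eq_graph_expectation => A _.
by rewrite /dual_monomial big_set0 mul1r.
Qed.
End Moments.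

(** * Low-degree polynomials as multilinear polynomials in the edges *)

Section Span.
Variable q : R.

(** Equality is asked on adjacency matrices only: there symmetry, the zero diagonal and Boolean
    entries reduce every polynomial to this multilinear form. *)
Definition low_degree_span (d : nat) F := exists c : {set 'I_n * 'I_n} -> R,
  forall A, is_adjacency A ->
    F A = \sum_(b : {set 'I_n * 'I_n} | (b \subset edges) && (#|b| <= d)%N)
            c b * shifted_monomial q b A.

Lemma eq_span d F G : (forall A, is_adjacency A -> F A = G A) ->
  low_degree_span d F -> low_degree_span d G.
Proof. by move=> FG [c Fc]; exists c => A adjA; rewrite -FG// Fc. Qed.

Lemma spanD d F G : low_degree_span d F -> low_degree_span d G ->
  low_degree_span d (fun A => F A + G A).
Proof.
move=> [c Fc] [c' Gc]; exists (fun b => c b + c' b) => A adjA.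
by rewrite Fc// Gc// -big_split; apply: eq_bigr => b _; rewrite mulrDl.
Qed.

Lemma spanZ d x F : low_degree_span d F -> low_degree_span d (fun A => x * F A).
Proof.
move=> [c Fc]; exists (fun b => x * c b) => A adjA.
by rewrite Fc// mulr_sumr; apply: eq_bigr => b _; rewrite mulrA.
Qed.

Lemma span0 d : low_degree_span d (fun=> 0).
Proof. by exists (fun=> 0) => A _; rewrite big1// => b _; rewrite mul0r. Qed.

Lemma span_sum d (I : eqType) (r : seq I) (H : I -> 'M[bool]_n -> R) :
  (forall i, i \in r -> low_degree_span d (H i)) ->
  low_degree_span d (fun A => \sum_(i <- r) H i A).
Proof.
elim: r => [|i r IH] Hr.
  by apply: eq_span (span0 d) => A _; rewrite big_nil.
apply: (@eq_span _ (fun A => H i A + \sum_(j <- r) H j A)).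
  by move=> A _; rewrite big_cons.
apply: spanD; first by apply: Hr; rewrite mem_head.
by apply: IH => j jr; apply: Hr; rewrite inE jr orbT.
Qed.

Lemma span_shifted d b : b \subset edges -> (#|b| <= d)%N ->
  low_degree_span d (shifted_monomial q b).
Proof.
move=> bE bd; exists (fun b' => (b' == b)%:R) => A _.
rewrite (bigD1 b) ?bE//= eqxx mul1r big1 ?addr0// => b' /andP[_ /negbTE->].
by rewrite mul0r.
Qed.

Lemma span_le d d' F : (d <= d')%N -> low_degree_span d F -> low_degree_span d' F.
Proof.
move=> dd' [c Fc]; pose H (b : {set 'I_n * 'I_n}) A : R :=
  if (b \subset edges) && (#|b| <= d)%N then c b * shifted_monomial q b A else 0.
apply: (@eq_span _ (fun A => \sum_(b <- index_enum {set 'I_n * 'I_n}) H b A)).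
  by move=> A adjA; rewrite Fc// [RHS]big_mkcond.
apply: span_sum => b _; rewrite /H; case: andP => [[bE bd]|_]; last exact: span0.
by apply/spanZ/span_shifted => //; exact: leq_trans dd'.
Qed.

Lemma span1 d : low_degree_span d (fun=> 1).
Proof.
apply: (@eq_span _ (shifted_monomial q set0)).
  by move=> A _; rewrite /shifted_monomial big_set0.
by apply: span_shifted; rewrite ?sub0set ?cards0.
Qed.

Lemma span_shifted_mul_edge d b p : b \subset edges -> (#|b| <= d)%N -> p \in edges ->
  low_degree_span d.+1 (fun A => (A p.1 p.2)%:R * shifted_monomial q b A).
Proof.
move=> bE bd pE; have [pb|pb] := boolP (p \in b).
  (* For Boolean [t], [t * (t - q) = (1 - q) * (t - q) + (1 - q) * q], so a repeated edge stays
     multilinear. *)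
  apply: (@eq_span _ (fun A => (1 - q) * shifted_monomial q b A +
                      (1 - q) * q * shifted_monomial q (b :\ p) A)).
    move=> A _; rewrite /shifted_monomial (big_setD1 p)//=.
    by case: (A _ _) => /=; ring.
  have bp : b :\ p \subset b by exact: subD1set.
  apply: spanD; apply/spanZ/span_shifted => //; first exact: leqW.
    exact: subset_trans bE.
  by apply: leq_trans (subset_leq_card bp) _; exact: leqW.
apply: (@eq_span _ (fun A => shifted_monomial q (p |: b) A + q * shifted_monomial q b A)).
  by move=> A _; rewrite /shifted_monomial big_setU1//=; ring.
apply: spanD; last by apply/spanZ/span_shifted => //; exact: leqW.
by apply: span_shifted; rewrite ?subUset ?sub1set ?pE// cardsU1 pb.
Qed.

Lemma span_mul_entry d F i j : low_degree_span d F ->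
  low_degree_span d.+1 (fun A => (A i j)%:R * F A).
Proof.
move=> [c Fc].
have [ij|] := eqVneq i j.
  by apply: eq_span (span0 _) => A adjA; rewrite ij adj_diag ?mul0r.
rewrite neq_ltn => ij.
have [p pE Ap] : exists2 p, p \in edges & forall A, is_adjacency A -> A i j = A p.1 p.2.
  case/orP: ij => ij; first by exists (i, j); rewrite ?inE.
  by exists (j, i); rewrite ?inE// => A /adj_sym ->.
pose H (b : {set 'I_n * 'I_n}) A : R :=
  if (b \subset edges) && (#|b| <= d)%N
  then c b * ((A p.1 p.2)%:R * shifted_monomial q b A) else 0.
apply: (@eq_span _ (fun A => \sum_(b <- index_enum {set 'I_n * 'I_n}) H b A)).
  move=> A adjA; rewrite Fc// Ap// mulr_sumr [RHS]big_mkcond.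
  by apply: eq_bigr => b _; rewrite /H; case: ifP => // _; rewrite mulrCA.
apply: span_sum => b _; rewrite /H; case: andP => [[bE bd]|_]; last exact: span0.
by apply: spanZ; exact: span_shifted_mul_edge.
Qed.

Lemma span_meval d (P : mpoly (n * n) R) : (msize P <= d.+1)%N ->
  low_degree_span d (fun A =>
    meval (fun v => mxvec (map_mx (fun b : bool => b%:R) A) 0 v) P).
Proof.
move=> Pd; pose x A v : R := mxvec (map_mx (fun b : bool => b%:R) A) 0 v.
apply: (@eq_span _ (fun A => \sum_(m <- msupp P) mcoeff m P * \prod_v x A v ^+ m v)).
  by move=> A _; rewrite mevalE.
apply: span_sum => m /msize_mdeg_lt md; apply: spanZ.
have {}md : (mdeg m <= d)%N by rewrite -ltnS; exact: leq_trans Pd.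
apply: span_le md _; rewrite mdegE.
(* The monomial is assembled one factor at a time, over the variables and then over each exponent;
   every factor raises the degree bound by one. *)
elim: (index_enum _) => [|v r IH].
  by rewrite big_nil; apply: eq_span (span1 0) => A _; rewrite big_nil.
rewrite big_cons.
apply: (@eq_span _ (fun A => x A v ^+ m v * \prod_(v <- r) x A v ^+ m v)).
  by move=> A _; rewrite big_cons.
elim: (m v) => [|e IHe].
  by rewrite add0n; apply: eq_span IH => A _; rewrite expr0 mul1r.
case/mxvec_indexP: v IHe => i j IHe.
rewrite addSn; apply: eq_span (span_mul_entry i j IHe) => A _.
by rewrite mulrA exprS; congr (_ * _ * _); rewrite /x mxvecE mxE.
Qed.
End Span.
End Graphs.

(** * The block prior and the risk bound *)

(** Squaring the weight bound and applying [rooted_weight_sum] at [y ^+ 2], sets of size [e]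
    contribute at most [y ^+ 2 * r ^+ e]. The ratio [r] is at most 1/5, and the geometric series
    gives 5/4. *)
Lemma dual_weight_sum (R : realFieldType) (V : finType) (r1 r2 : V)
    (w : {set V * V} -> R) (y t : R) (D : nat) :
  r1 != r2 -> 0 <= y <= 1 -> 0 <= t -> 1 <= #|V|%:R * y ^+ 2 ->
  (forall a, ~~ rooted r1 r2 a -> w a = 0) ->
  (forall a, `|w a| <= (#|a|.+1 ^ #|a|)%:R * y ^+ #|reach r1 r2 a :\ r1|) ->
  D.+1%:R ^+ 2 * t * (12 * D%:R ^+ 2 * (#|V|%:R * y ^+ 2)) <= 5^-1 ->
  \sum_(a : {set V * V} | (#|a| <= D)%N) w a ^+ 2 * t ^+ #|a| <= 5 / 4 * y ^+ 2.
Proof.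
move=> r12 /andP[y0 y1] t0 ny w0 wle; set B := 12 * _ * _ => rB.
have y201 : 0 <= y ^+ 2 <= 1 by rewrite sqr_ge0 expr_le1.
have B0 : 0 <= B by rewrite /B !mulr_ge0// ?sqr_ge0.
pose T e := \sum_(a : {set V * V} | rooted r1 r2 a && (#|a| == e))
  (y ^+ 2) ^+ #|reach r1 r2 a :\ r1|.
have TB e : (e <= D)%N -> T e <= y ^+ 2 * B ^+ e.
  elim: e => [_|e IH eD].
    (* The empty set reaches two distinct roots, whence the leading factor [y ^+ 2]. *)
    rewrite /T (big_pred1 set0) => [|a]; last first.
      rewrite /= cards_eq0; apply/andP/eqP => [[_ /eqP]//|->].
      by rewrite rooted0 eqxx.
    rewrite expr0 mulr1 (_ : #|_| = 1%N) ?expr1//.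
    have -> : reach r1 r2 set0 :\ r1 = [set r2].
      rewrite /reach !imset0 !setU0 setU1K// inE//.
    by rewrite cards1.
  have := rooted_weight_sum r1 r2 y201 eD ny; rewrite -/B -/(T e) -/(T e.+1).
  move=> h; apply: le_trans h _.
  by rewrite [B ^+ e.+1]exprS mulrCA ler_wpM2l// IH// ltnW.
pose r := D.+1%:R ^+ 2 * t * B.
have r0 : 0 <= r by rewrite /r !mulr_ge0// sqr_ge0.
apply: (@le_trans _ _ (\sum_(e < D.+1) y ^+ 2 * r ^+ e)).
  rewrite (partition_big (fun a : {set V * V} => inord #|a| : 'I_D.+1) predT) //=.
  apply: ler_sum => e _.
  have eD : (e <= D)%N by rewrite -ltnS.
  apply: (@le_trans _ _ (\sum_(a : {set V * V} | rooted r1 r2 a && (#|a| == e))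
     (D.+1%:R ^+ 2 * t) ^+ e * (y ^+ 2) ^+ #|reach r1 r2 a :\ r1|)).
    rewrite [leLHS]big_mkcond [leRHS]big_mkcond; apply: ler_sum => a _ /=.
    have [ra|/w0 ->] := boolP (rooted r1 r2 a); last first.
      by rewrite expr0n mul0r; case: ifP.
    case: ifPn => [/andP[aD /eqP ae]|_]; last first.
      by case: ifP => // _; rewrite !mulr_ge0 ?exprn_ge0 ?mulr_ge0 ?exprn_ge0.
    have {}ae : #|a| = e by rewrite -ae inordK.
    rewrite ae eqxx /= exprMn [leRHS]mulrAC ler_wpM2r ?exprn_ge0//.
    rewrite -[w a ^+ 2]real_normK ?num_real// -!exprM mulnC (mulnC 2%N) !exprM -exprMn.
    rewrite lerXn2r ?nnegrE ?mulr_ge0 ?exprn_ge0//.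
    apply: le_trans (wle a) _; rewrite ler_wpM2r ?exprn_ge0// -natrX ler_nat ae.
    by case: (e : nat) eD => [|m] mD; rewrite ?expn0// leq_exp2r.
  rewrite -mulr_sumr mulrC.
  apply: le_trans (ler_wpM2r _ (TB e eD)) _.
    by rewrite !exprn_ge0// mulr_ge0// sqr_ge0.
  by rewrite -mulrA -exprMn [B * _]mulrC.
rewrite -mulr_sumr mulrC ler_wpM2r ?sqr_ge0//.
have : forall m, \sum_(e < m) r ^+ e <= 5 / 4 * (1 - 5^-1 ^+ m).
  elim=> [|m IH]; first by rewrite big_ord0 expr0 subrr mulr0.
  rewrite big_ord_recr /=.
  have h : r ^+ m <= 5^-1 ^+ m by rewrite lerXn2r ?nnegrE ?invr_ge0.
  rewrite [5^-1 ^+ m.+1]exprS; lra.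
move=> /(_ D.+1) h; apply: le_trans h _.
have : 0 <= 5^-1 ^+ D.+1 :> R by rewrite exprn_ge0 ?invr_ge0.
lra.
Qed.

(** * The dual witness and the Bayes risk of one pair *)

Section BlockModel.
Variables (R : realType) (n k : nat) (q eps : R).
Hypotheses (k_gt0 : (0 < k)%N) (q0 : 0 < q) (eps0 : 0 <= eps) (qeps : q + eps <= 2^-1).
Implicit Types (z : {ffun 'I_n -> 'I_k}) (A : 'M[bool]_n).

Definition block_matrix z : 'M[R]_n :=
  \matrix_(i, j) if i == j then 0 else q + eps * (z i == z j)%:R.

Let C_gt0 : (0 < #|'I_k|)%N. Proof. by rewrite card_ord. Qed.

Lemma block_matrix_edge z (p : 'I_n * 'I_n) : p \in edges n ->
  block_matrix z p.1 p.2 = q + eps * (z p.1 == z p.2)%:R.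
Proof. by rewrite inE mxE => h; rewrite -val_eqE /= ltn_eqF. Qed.

Lemma block_matrix_bounds z (p : 'I_n * 'I_n) : p \in edges n ->
  q <= block_matrix z p.1 p.2 <= 2^-1.
Proof.
move=> pE; rewrite block_matrix_edge//.
by case: (_ == _); rewrite ?mulr1 ?mulr0; apply/andP; split; have := qeps; have := eps0; lra.
Qed.

Lemma block_matrix_prob z (p : 'I_n * 'I_n) : p \in edges n ->
  0 < block_matrix z p.1 p.2 < 1.
Proof.
by move=> /(block_matrix_bounds z) /andP[h1 h2]; apply/andP; split; have := q0; lra.
Qed.

Lemma prod_block_matrix z (g : {set 'I_n * 'I_n}) : g \subset edges n ->
  \prod_(p in g) (block_matrix z p.1 p.2 - q) = eps ^+ #|g| * (mono z g)%:R.
Proof.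
move=> gE.
rewrite (eq_bigr (fun p => eps * (z p.1 == z p.2)%:R)); last first.
  by move=> p pg; rewrite block_matrix_edge ?(subsetP gE)//; ring.
rewrite big_split /= prodr_const; congr (_ * _).
have [/monoP m|] := boolP (mono z g).
  by rewrite big1// => p /m ->; rewrite eqxx.
by move=> /forall_inPn[p pg ne]; rewrite (bigD1 p)//= (negbTE ne) mul0r.
Qed.

Variables (r1 r2 : 'I_n) (w : {set 'I_n * 'I_n} -> R) (D : nat).
Hypothesis r12 : r1 != r2.
Hypothesis wE : forall b : {set 'I_n * 'I_n}, \sum_(a : {set 'I_n * 'I_n} | a \subset b)
    w a * avg (fun z : {ffun 'I_n -> 'I_k} => (mono z (b :\: a))%:R) =
  avg (fun z : {ffun 'I_n -> 'I_k} => (mono z b && (z r1 == z r2))%:R).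

Let x z : R := (z r1 == z r2)%:R.
Let low (a : {set 'I_n * 'I_n}) := (a \subset edges n) && (#|a| <= D)%N.

Definition dual_witness z A : R :=
  \sum_(a | low a) eps ^+ #|a| * w a * dual_monomial (block_matrix z) a A.

(** Only [a \subset b] survive, and [eps ^+ #|a|] joins the [eps ^+ #|b :\: a|] of the moment into a
    common [eps ^+ #|b|]; what remains is the system [wE]. *)
Lemma dual_witness_shifted b : low b ->
  avg (fun z => graph_expectation (block_matrix z)
      (fun A => dual_witness z A * shifted_monomial q b A)) =
  avg (fun z => graph_expectation (block_matrix z)
      (fun A => x z * shifted_monomial q b A)).
Proof.
move=> /andP[bE bD].
transitivity (eps ^+ #|b| *
  avg (fun z : {ffun 'I_n -> 'I_k} => (mono z b && (z r1 == z r2))%:R)).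
  rewrite -wE mulr_sumr.
  rewrite (eq_avg (G := fun z => \sum_(a | low a && (a \subset b))
      eps ^+ #|b| * w a * (mono z (b :\: a))%:R)); last first.
    move=> z; under eq_graph_expectation do rewrite mulr_suml.
    rewrite graph_expectation_sum [RHS]big_mkcondr; apply: eq_bigr => a /andP[aE aD].
    under eq_graph_expectation do rewrite -mulrA.
    rewrite graph_expectationZ dual_shifted_moment//; last exact: block_matrix_prob.
    case: ifP => ab; last by rewrite mul0r mulr0.
    rewrite mul1r prod_block_matrix; last exact: subset_trans (subsetDl _ _) bE.
    rewrite !mulrA; congr (_ * _); rewrite mulrAC -exprD; congr (_ ^+ _ * _).
    by rewrite cardsD (setIidPr ab) subnKC// subset_leq_card.
  rewrite avg_sum; apply: eq_big => [a|a _].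
    apply/andP/idP => [[]//|ab]; split => //; apply/andP; split.
      exact: subset_trans bE.
    exact: leq_trans (subset_leq_card ab) bD.
  by rewrite avgZ mulrA.
rewrite -avgZ; apply: eq_avg => z; rewrite graph_expectationZ.
rewrite shifted_moment//; last exact: block_matrix_prob.
by rewrite prod_block_matrix// -mulnb natrM /x; ring.
Qed.

Lemma dual_witness_correlation F : low_degree_span q D F ->
  avg (fun z => graph_expectation (block_matrix z) (fun A => dual_witness z A * F A)) =
  avg (fun z => graph_expectation (block_matrix z) (fun A => x z * F A)).
Proof.
move=> [c Fc].
have E (U : {ffun 'I_n -> 'I_k} -> 'M[bool]_n -> R) :
    avg (fun z => graph_expectation (block_matrix z) (fun A => U z A * F A)) =
    \sum_(b | low b) c b * avg (fun z => graph_expectation (block_matrix z)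
        (fun A => U z A * shifted_monomial q b A)).
  rewrite (eq_avg (G := fun z => \sum_(b | low b) c b *
      graph_expectation (block_matrix z) (fun A => U z A * shifted_monomial q b A))).
    by rewrite avg_sum; apply: eq_bigr => b _; rewrite avgZ.
  move=> z; rewrite (@eq_graph_expectation _ _ _ _ (fun A => \sum_(b | low b)
      c b * (U z A * shifted_monomial q b A))).
    by rewrite graph_expectation_sum; apply: eq_bigr => b _; rewrite graph_expectationZ.
  by move=> A adjA; rewrite Fc// mulr_sumr; apply: eq_bigr => b _; rewrite mulrCA.
by rewrite !E; apply: eq_bigr => b lb; rewrite dual_witness_shifted.
Qed.

(** Orthogonality leaves the diagonal terms; each edge costs at most [2 / q], since an edge
    probability [m] between [q] and 1/2 has [m * (1 - m) >= q / 2]. *)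
Lemma dual_witness_norm :
  avg (fun z => graph_expectation (block_matrix z) (fun A => dual_witness z A ^+ 2)) <=
  \sum_(a | low a) w a ^+ 2 * (eps ^+ 2 * (2 / q)) ^+ #|a|.
Proof.
rewrite -[leRHS](avg_cst 'I_n C_gt0); apply: ler_avg => z.
rewrite (@eq_graph_expectation _ _ _ _ (fun A => \sum_(a | low a) \sum_(b | low b)
   (eps ^+ #|a| * w a * (eps ^+ #|b| * w b)) *
   (dual_monomial (block_matrix z) a A * dual_monomial (block_matrix z) b A))); last first.
  move=> A _; rewrite expr2 mulr_suml; apply: eq_bigr => a _.
  by rewrite mulr_sumr; apply: eq_bigr => b _; rewrite mulrACA.
rewrite graph_expectation_sum; apply: ler_sum => a la; have /andP[aE aD] := la.
rewrite graph_expectation_sum (bigD1 a)//= big1 ?addr0; last first.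
  move=> b /andP[/andP[bE bD] ba]; rewrite graph_expectationZ.
  rewrite dual_moment//; last exact: block_matrix_prob.
  by rewrite [a == b]eq_sym (negbTE ba) mul0r mulr0.
rewrite graph_expectationZ dual_moment//; last exact: block_matrix_prob.
rewrite eqxx mul1r exprMn.
have -> : eps ^+ #|a| * w a * (eps ^+ #|a| * w a) = w a ^+ 2 * (eps ^+ 2) ^+ #|a|.
  by rewrite -exprM mulnC exprM !expr2; ring.
rewrite mulrA ler_wpM2l ?(mulr_ge0 (sqr_ge0 _)) ?exprn_ge0 ?sqr_ge0//.
rewrite -prodr_const; apply: ler_prod => p pa.
have /andP[h1 h2] := block_matrix_bounds z (subsetP aE p pa).
set m := block_matrix z p.1 p.2 in h1 h2 *.
have mq : q / 2 <= m * (1 - m) by have := q0; nra.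
have q20 : 0 < q / 2 by rewrite divr_gt0.
rewrite invr_ge0 (le_trans (ltW q20) mq) /=.
by rewrite -[2 / q]invf_div lef_pV2 ?posrE// (lt_le_trans q20).
Qed.

Lemma pair_risk_lower_bound F : low_degree_span q D F ->
  eps ^+ 2 * (k%:R^-1 - \sum_(a | low a) w a ^+ 2 * (eps ^+ 2 * (2 / q)) ^+ #|a|) <=
  avg (fun z => graph_expectation (block_matrix z)
                    (fun A => (F A - block_matrix z r1 r2) ^+ 2)).
Proof.
move=> spF.
pose g A := F A + - q * 1.
have spg : low_degree_span q D g by apply: spanD => //; apply/spanZ/span1.
(* [(g - eps x)^2 = (g - eps u)^2 + 2 eps (u g - x g) + eps^2 (x^2 - u^2)] and
   [x^2 = x]. *)
pose J (G : {ffun 'I_n -> 'I_k} -> 'M[bool]_n -> R) :=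
  avg (fun z => graph_expectation (block_matrix z) (G z)).
have JD G H : J (fun z A => G z A + H z A) = J G + J H.
  by rewrite /J -avgD; apply: eq_avg => z; rewrite graph_expectationD.
have JZ t G : J (fun z A => t * G z A) = t * J G.
  by rewrite /J -avgZ; apply: eq_avg => z; rewrite graph_expectationZ.
have Jx : J (fun z _ => x z * 1) = k%:R^-1.
  rewrite -[in RHS](card_ord k) -(avg_eq_at R C_gt0 r12); apply: eq_avg => z.
  by rewrite graph_expectationZ graph_expectation1 mulr1.
have -> : avg (fun z => graph_expectation (block_matrix z)
      (fun A => (F A - block_matrix z r1 r2) ^+ 2)) =
    J (fun z A => (g A - eps * dual_witness z A) ^+ 2) +
    (2 * eps * (J (fun z A => dual_witness z A * g A) +
                -1 * J (fun z A => x z * g A)) +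
    eps ^+ 2 * (J (fun z _ => x z * 1) +
                -1 * J (fun z A => dual_witness z A ^+ 2))).
  rewrite -(JZ (-1) (fun z A => x z * g A)) -JD -JZ.
  rewrite -(JZ (-1) (fun z A => dual_witness z A ^+ 2)) -JD -JZ -!JD.
  apply: eq_avg => z; apply: eq_graph_expectation => A _.
  by rewrite mxE (negbTE r12) /g /x; case: (_ == _) => /=; ring.
(* Duality cancels the cross terms; the remaining square is nonnegative and is dropped. *)
rewrite {2}/J dual_witness_correlation// -/(J _) mulN1r subrr mulr0 add0r Jx mulN1r.
apply: ler_wpDl.
  apply: avg_ge0 => // z; apply: graph_expectation_ge0 => [p|A]; last exact: sqr_ge0.
  by move=> /(block_matrix_prob z) /andP[/ltW-> /ltW->].
rewrite ler_wpM2l ?sqr_ge0// lerB//; exact: dual_witness_norm.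
Qed.
End BlockModel.

Lemma sum_lt_pairs (n : nat) : (\sum_(i < n) \sum_(j < n | i < j) 1 = 'C(n, 2))%N.
Proof.
rewrite (exchange_big_dep predT)//= -bin2_sum big_mkord; apply: eq_bigr => j _.
by rewrite (big_ord_narrow (ltnW (ltn_ord j))) sum_nat_const card_ord muln1.
Qed.

Lemma block_matrix_sbm (R : realType) (n k : nat) (q eps rho : R)
    (z : {ffun 'I_n -> 'I_k}) :
  0 < q -> 0 <= eps -> q + eps <= rho -> sbm_class k rho (block_matrix q eps z).
Proof.
move=> q0 e0 qe.
have H (b : bool) : 0 <= q + eps * b%:R <= rho.
  by case: b; rewrite ?mulr1 ?mulr0; apply/andP; split; lra.
split => [i j|]; first by rewrite mxE; case: ifP => // _; lra.
split => [i|]; first by rewrite mxE eqxx.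
exists z, (\matrix_(a, b) (q + eps * (a == b)%:R)); split => [|a b|i j ij].
- by apply/matrixP => a b; rewrite !mxE eq_sym.
- by rewrite mxE.
- by rewrite !mxE [j == i]eq_sym (negbTE ij) [z j == _]eq_sym.
Qed.

(** The loss is an average over pairs, so it suffices to bound each pair [i, j], with dual weights
    rooted at that pair. *)
Lemma bayes_risk_lower_bound (R : realType) (n k D : nat) (q eps : R)
    (Mhat : 'M[bool]_n -> 'M[R]_n) :
  (1 < k)%N -> (1 < n)%N -> 0 < q -> 0 <= eps -> q + eps <= 2^-1 ->
  1 <= n%:R * k%:R^-1 ^+ 2 :> R ->
  D.+1%:R ^+ 2 * (eps ^+ 2 * (2 / q)) *
    (12 * D%:R ^+ 2 * (n%:R * k%:R^-1 ^+ 2)) <= 5^-1 ->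
  @low_degree_estimator R n D Mhat ->
  eps ^+ 2 * (3 / 8 / k%:R) <=
  avg (fun z : {ffun 'I_n -> 'I_k} => graph_expectation (block_matrix q eps z)
    (fun A => loss (Mhat A) (block_matrix q eps z))).
Proof.
move=> k1 n1 q0 e0 qe ny small ld.
have k0 : (0 < k)%N by exact: ltnW.
have C0 : (0 < #|'I_k|)%N by rewrite card_ord.
have kR : 2 <= k%:R :> R by rewrite (ler_nat _ 2).
have y01 : 0 <= (k%:R^-1 : R) <= 1.
  by rewrite invr_ge0 ler0n invf_le1 ?ltr0n// ler1n.
pose J := fun F : {ffun 'I_n -> 'I_k} -> 'M[bool]_n -> R =>
  avg (fun z => graph_expectation (block_matrix q eps z) (F z)).
have pairE i j : i != j -> eps ^+ 2 * (3 / 8 / k%:R) <=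
    J (fun z A => (Mhat A i j - block_matrix q eps z i j) ^+ 2).
  move=> ij.
  have [w [w0 wE wle]] := @exists_dual_weights R 'I_n 'I_k i j C0.
  have sp : low_degree_span q D (fun A => Mhat A i j).
    have [P Pd PE] := ld i j.
    by apply: eq_span (span_meval q Pd) => A _; rewrite PE.
  have lb := pair_risk_lower_bound k0 q0 e0 qe ij wE sp.
  apply: le_trans _ lb; rewrite ler_wpM2l ?sqr_ge0//.
  have := @dual_weight_sum R 'I_n i j w k%:R^-1 (eps ^+ 2 * (2 / q)) D ij y01.
  rewrite card_ord => /(_ _ ny w0 _ small) H.
  have t0 : 0 <= eps ^+ 2 * (2 / q).
    by rewrite mulr_ge0 ?sqr_ge0// divr_ge0// ltW.
  have {H}S : \sum_(a : {set 'I_n * 'I_n} | (a \subset edges n) && (#|a| <= D)%N)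
      w a ^+ 2 * (eps ^+ 2 * (2 / q)) ^+ #|a| <= 5 / 4 * k%:R^-1 ^+ 2.
    apply: le_trans _ (H t0 _); last by move: wle; rewrite card_ord.
    rewrite [leLHS]big_mkcond [leRHS]big_mkcond; apply: ler_sum => a _.
    case: (a \subset _) => //=; case: ifP => // _.
    exact: mulr_ge0 (sqr_ge0 _) (exprn_ge0 _ t0).
  (* As [k >= 2], the dual norm is at most [5 / 8 / k], leaving [3 / 8 / k]. *)
  have yy : k%:R^-1 ^+ 2 <= 2^-1 * k%:R^-1 :> R.
    rewrite expr2 ler_wpM2r ?invr_ge0// lef_pV2 ?posrE//; lra.
  lra.
change (eps ^+ 2 * (3 / 8 / k%:R) <= J (fun z A => loss (Mhat A) (block_matrix q eps z))).
have -> : J (fun z A => loss (Mhat A) (block_matrix q eps z)) =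
    'C(n, 2)%:R^-1 * \sum_(i < n) \sum_(j < n | (i < j)%N)
      J (fun z A => (Mhat A i j - block_matrix q eps z i j) ^+ 2).
  rewrite /J; under [in RHS]eq_bigr do rewrite -avg_sum.
  rewrite -avg_sum -avgZ; apply: eq_avg => z.
  rewrite /loss graph_expectationZ graph_expectation_sum; congr (_ * _).
  by apply: eq_bigr => i _; rewrite graph_expectation_sum.
rewrite [leRHS]mulrC ler_pdivlMr ?ltr0n ?bin_gt0//.
rewrite -[X in _ * X%:R]sum_lt_pairs natr_sum mulr_sumr; apply: ler_sum => i _.
rewrite natr_sum mulr_sumr; apply: ler_sum => j ij.
by rewrite mulr1 pairE// -val_eqE ltn_eqF.
Qed.

(** * Choice of parameters and passage from Bayes to minimax risk *)

Local Open Scope classical_set_scope.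
Local Open Scope ring_scope.

Theorem theorem6 (R : realType) (c : R) (hc : 0 < c < 1) :
  exists c' : R, 0 < c' /\
    forall (n k : nat) (rho : R) (D : nat),
      (2 <= k)%N -> k%:R <= Num.sqrt (n%:R : R) ->
      0 < rho < 1 -> c * k%:R ^+ 2 / n%:R <= rho ->
      (1 <= D)%N ->
      ((c' * rho * k%:R / (n%:R * D%:R ^+ 4))%:E <=
       ereal_inf [set ereal_sup [set (graph_expectation M
                                        (fun A => loss (Mhat A) M))%:E
                                | M in @sbm_class R n k rho]
                 | Mhat in @low_degree_estimator R n D])%E.
Proof.
have /andP[c0 c1] := hc.
(* This is [3 / 8 * d] with [d = c / 2000], the constant in [e2] below. *)
exists (3 * c / 16000); split; first by lra.
move=> n k rho D k2 kn /andP[rho0 rho1] crho D1.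
have kR : 2 <= k%:R :> R by rewrite (ler_nat _ 2).
have kn2 : k%:R ^+ 2 <= n%:R :> R.
  by rewrite -(sqr_sqrtr (ler0n R n)) lerXn2r// nnegrE ?sqrtr_ge0.
have n0 : 0 < n%:R :> R by apply: lt_le_trans kn2; rewrite exprn_gt0//; lra.
have n1 : (1 < n)%N by rewrite -(ltr_nat R); apply: lt_le_trans kn2; nra.
have DR : 1 <= D%:R :> R by rewrite ler1n.
have D0 : 0 < D%:R :> R by lra.
have k0 : 0 < k%:R :> R by lra.
have [d dE] : {d : R | d = c / 2000} by exists (c / 2000).
pose q := rho / 4.
pose e2 := d * rho * k%:R ^+ 2 / (n%:R * D%:R ^+ 4).
pose eps := Num.sqrt e2.
have d0 : 0 < d by rewrite dE; lra.
have e20 : 0 <= e2.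
  by rewrite /e2 divr_ge0 ?mulr_ge0 ?exprn_ge0// ltW.
have epsE : eps ^+ 2 = e2 by rewrite sqr_sqrtr.
have eps0 : 0 <= eps by exact: sqrtr_ge0.
(* The lower bound on [rho] gives [e2 <= rho ^+ 2 / 2000], which keeps [q + eps] below both [rho]
   and 1/2. *)
have eps_le : eps <= rho / 4.
  rewrite -(@ler_pXn2r _ 2) ?nnegrE ?divr_ge0 ?(ltW rho0)// epsE.
  have D4 : 1 <= D%:R ^+ 4 :> R by rewrite exprn_ege1.
  apply: (@le_trans _ _ (d * rho * k%:R ^+ 2 / n%:R)).
    rewrite /e2 ler_wpM2l ?mulr_ge0 ?exprn_ge0 ?(ltW d0) ?(ltW rho0)//.
    by rewrite lef_pV2 ?posrE ?mulr_gt0 ?exprn_gt0// ler_peMr// ltW.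
  have -> : d * rho * k%:R ^+ 2 / n%:R = rho / 2000 * (c * k%:R ^+ 2 / n%:R).
    by rewrite dE; field; rewrite gt_eqF.
  apply: (@le_trans _ _ (rho / 2000 * rho)).
    apply: ler_wpM2l crho; lra.
  by rewrite expr2; nra.
have q0 : 0 < q by rewrite divr_gt0.
have qe : q + eps <= rho / 2 by rewrite /q; lra.
have qe2 : q + eps <= 2^-1 by lra.
have ny : 1 <= n%:R * k%:R^-1 ^+ 2 :> R.
  by rewrite exprVn ler_pdivlMr ?exprn_gt0// mul1r.
have small : D.+1%:R ^+ 2 * (eps ^+ 2 * (2 / q)) *
    (12 * D%:R ^+ 2 * (n%:R * k%:R^-1 ^+ 2)) <= 5^-1.
  rewrite epsE.
  (* The choice of [e2] cancels [n], [k] and [rho]; with [(D + 1) / D <= 2] the rest is at most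
     [384 * d], below 1/5 because [c < 1]. *)
  have -> : D.+1%:R ^+ 2 * (e2 * (2 / q)) *
      (12 * D%:R ^+ 2 * (n%:R * k%:R^-1 ^+ 2)) =
      96 * d * (D.+1%:R / D%:R) ^+ 2.
    by rewrite /e2 /q; field; rewrite !gt_eqF.
  have h : D.+1%:R / D%:R <= 2 :> R.
    by rewrite ler_pdivrMr// -natr1; lra.
  have h2 : (D.+1%:R / D%:R) ^+ 2 <= 4 :> R.
    have -> : 4 = 2 ^+ 2 :> R by ring.
    by rewrite lerXn2r ?nnegrE ?divr_ge0.
  apply: (@le_trans _ _ (96 * d * 4)); last by rewrite dE; lra.
  by rewrite ler_wpM2l// mulr_ge0// ltW.
apply: le_ereal_inf_tmp => _ [Mhat ld <-].
have bayes := bayes_risk_lower_bound k2 n1 q0 eps0 qe2 ny small ld.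
set S := ereal_sup _.
have leS (z : {ffun 'I_n -> 'I_k}) : ((graph_expectation (block_matrix q eps z)
    (fun A => loss (Mhat A) (block_matrix q eps z)))%:E <= S)%E.
  apply: ereal_sup_ubound; exists (@block_matrix R n k q eps z) => //.
  by apply: block_matrix_sbm => //; lra.
have k0n : (0 < k)%N by exact: ltnW.
have C0 : (0 < #|'I_k|)%N by rewrite card_ord.
(* The supremum may be infinite, which is trivial; minus infinity is excluded by a constant
   labelling. A finite one dominates the average. *)
move: leS; case: S => [s||] leS; last 2 first.
- by rewrite leey.
- by have := leS (finfun (fun=> Ordinal k0n)).
rewrite lee_fin; apply: le_trans (le_trans bayes _).
  rewrite epsE le_eqVlt; apply/orP; left; apply/eqP.
  by rewrite /e2 dE; field; rewrite !gt_eqF.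
rewrite -[leRHS](avg_cst 'I_n C0); apply: ler_avg => z.
by rewrite -lee_fin.
Qed.
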